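(* Let $r\ge 1$ and let $(R_{\alpha,k})_{\alpha\in\{0,\dots,r+1\},k\in\mathbb Z}$ satisfy the $A_r$ $Q$-system $$R_{\alpha,k+1}R_{\alpha,k-1}=R_{\alpha,k}^2+R_{\alpha+1,k}R_{\alpha-1,k}\quad(1\le\alpha\le r,\ k\in\mathbb Z),\qquad R_{0,k}=R_{r+1,k}=1 .$$ Let $\mathbf m=(m_1,\dots,m_r)\in\mathbb Z^r$ be any Motzkin path, i.e. $m_{i+1}-m_i\in\{-1,0,1\}$ for $1\le i<r$, and let $\mathbf x_{\mathbf m}=\{R_{\alpha,m_\alpha},R_{\alpha,m_\alpha+1}\}_{\alpha=1}^r$ be the associated initial data, regarded as $2r$ independent commuting indeterminates (the system then determines every $R_{\alpha,n}$ as a rational function of them). Then for every $\alpha\in\{1,\dots,r\}$ and $n\in\mathbb Z$, $R_{\alpha,n}$ is a Laurent polynomial in the variables of $\mathbf x_{\mathbf m}$ with non-negative integer coefficients. *)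

(* Defs.v *)
From HB Require Import structures.
From mathcomp Require Import all_boot all_order all_algebra.
Set Implicit Arguments. Unset Strict Implicit. Unset Printing Implicit Defensive.
Import Order.TTheory GRing.Theory Num.Theory.
Local Open Scope ring_scope.

Definition Qsystem (F : fieldType) (r : nat) (R : nat -> int -> F) : Prop :=
  (forall k : int, R 0%N k = 1 /\ R r.+1 k = 1) /\
  (forall (a : nat) (k : int), (1 <= a <= r)%N ->
     R a (k + 1) * R a (k - 1) = R a k ^+ 2 + R a.+1 k * R a.-1 k).

Definition motzkin (r : nat) (m : nat -> int) : Prop :=
  forall i : nat, (1 <= i < r)%N -> `|m i.+1 - m i| <= 1.

(* A Laurent polynomial with non-negative integer coefficients in the 2r
   variables x_1..x_r, y_1..y_r, given as a finite list of monomials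
   (c, (a, b)) meaning c * prod_i x_i^(a_i) * y_i^(b_i). *)
Definition natLaurent (r : nat) : Type :=
  seq (nat * ({ffun 'I_r -> int} * {ffun 'I_r -> int})).

Definition laurent_eval (F : fieldType) (r : nat) (P : natLaurent r)
    (x y : 'I_r -> F) : F :=
  \sum_(t <- P) (t.1)%:R * \prod_(i < r) (x i ^ (t.2.1 i) * y i ^ (t.2.2 i)).

(* Main.v *)
(* Di Francesco's network matrices, in fermionic form.  To the rows 1..r at
   levels k_1..k_r one associates local transfer operators acting on the
   exterior algebra of F^(r+1): R_i lowers row i and L_i raises it, with weights
   that are positive Laurent monomials in the values T_i(k_i) met on the way.
   R_i and L_j commute for i != j, and the Q-system is exactly what makes R_i
   and L_i commute at states where the neighbouring rows are at the level of
   row i.  For a Motzkin path m the product of all R_i (highest level first)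
   therefore commutes, at the states m + c, with the product of all L_i (lowest
   level first).  The vacuum vector is fixed by the R_i, and the vacuum
   amplitude absorbs the L_i, so the amplitude of (RL)^p started at m + 1 equals
   T_alpha(m_alpha + 1 + p).  Started at m + 1, the word (RL)^p only visits
   levels m_i and m_i + 1, so its expansion is a Laurent polynomial with
   non-negative coefficients in the initial data.  The other half of the values
   follows from the symmetry k -> -k of the Q-system. *)

Require Import Defs.
From HB Require Import structures.
From mathcomp Require Import all_boot all_order all_algebra.
From mathcomp Require Import zify ring.
From Stdlib Require Import FunctionalExtensionality.
Import Order.TTheory GRing.Theory Num.Theory.
Local Open Scope ring_scope.

(** * Row levels, occupied sites and the local operators *)

Definition dir (e : bool) : int := if e then -1 else 1.
Definition step (e : bool) (i : nat) (k : nat -> int) : nat -> int :=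
  fun j => if j == i then k j + dir e else k j.
(** No sign appears, since particles only hop between adjacent sites. *)
Definition hop (s t : nat) (I : nat -> bool) : nat -> bool :=
  fun j => if j == s then false else if j == t then true else I j.
Definition src (e : bool) (i : nat) := if e then i else i.+1.
Definition tgt (e : bool) (i : nat) := if e then i.+1 else i.
Definition nbr (e : bool) (i : nat) := if e then i.-1 else i.+1.
Definition moves (e : bool) (s : seq nat) (k : nat -> int) :=
  foldl (fun k i => step e i k) k s.

(* The operator R_i (e = true) or L_i (e = false) acting on functions of the
   state k and of the set I of occupied sites, i.e. a basis vector of the
   exterior algebra.  On the span of the sites i and i+1 these are the matrices
     R_i = [[a/b, v/b], [0, 1]]   and   L_i = [[1, 0], [u/b, a/b]],
   where a and b are the old and new values of row i, and v and u the current
   values of rows i-1 and i+1. *)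
Definition chip (F : fieldType) (T : nat -> int -> F) (e : bool) (i : nat)
    (f : (nat -> int) -> (nat -> bool) -> F) (k : nat -> int) (I : nat -> bool) : F :=
  (if I (src e i) then T i (k i) / T i (step e i k i) else 1) * f (step e i k) I
  + (if I (src e i) && ~~ I (tgt e i)
     then T (nbr e i) (k (nbr e i)) / T i (step e i k i)
          * f (step e i k) (hop (src e i) (tgt e i) I)
     else 0).

Arguments chip {F}.

(** The head of [s] moves the state first, so a word at [k] reads [f] only at [moves e s k].
    Relations valid at a single state can thus be used inside words. *)
Definition chips (F : fieldType) (T : nat -> int -> F) (e : bool) (s : seq nat)
    (f : (nat -> int) -> (nat -> bool) -> F) :=
  foldr (chip T e) f s.

Arguments chips {F}.

Lemma step_id e i k : step e i k i = k i + dir e.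
Proof. by rewrite /step eqxx. Qed.

Lemma step_neq e i j k : j != i -> step e i k j = k j.
Proof. by rewrite /step => /negbTE->. Qed.

Lemma stepC e e' i j k : step e i (step e' j k) = step e' j (step e i k).
Proof.
apply: functional_extensionality => x; rewrite /step.
by case: eqP => _; case: eqP => _ //; rewrite addrAC.
Qed.

Lemma step_cancel e i k : step e i (step (~~ e) i k) = k.
Proof.
apply: functional_extensionality => x; rewrite /step.
by case: eqP => // _; case: e => /=; rewrite -addrA ?addNr ?addrN addr0.
Qed.

Lemma hopE s t I j :
  hop s t I j = if j == s then false else if j == t then true else I j.
Proof. by []. Qed.

Lemma hopC s t s' t' I : s != s' -> s != t' -> t != s' ->
  hop s t (hop s' t' I) = hop s' t' (hop s t I).
Proof.
move=> h1 h2 h4; apply: functional_extensionality => x; rewrite /hop.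
by do !case: eqP => ? //; subst; move: h1 h2 h4; rewrite ?eqxx.
Qed.

Lemma hopK s t (I : nat -> bool) : I s -> ~~ I t -> hop t s (hop s t I) = I.
Proof.
move=> Is It; apply: functional_extensionality => x; rewrite /hop.
case: eqP => [->|_]; first by apply/esym/negbTE.
by case: eqP => [->|].
Qed.

Lemma movesE e s k j : moves e s k j = k j + dir e * (count_mem j s)%:Z.
Proof.
elim: s k => [|i s IH] k /=; first by rewrite mulr0 addr0.
rewrite /moves /= -/(moves e s _) IH /step eq_sym.
by rewrite /dir; case: e {IH}; case: eqP => _ /=; lia.
Qed.

Ltac decide_nat_eqs :=
  repeat match goal with
  | |- context [?a == ?b :> nat] =>
      first [ rewrite (_ : (a == b) = false); last by lia
            | rewrite (_ : (a == b) = true); last by lia ]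
  end.

(** * Commutation relations of the local operators *)

Section Relations.
Variables (F : fieldType) (r : nat) (T : nat -> int -> F).
Hypothesis T_neq0 : forall a k, (a <= r.+1)%N -> T a k != 0.

Lemma chips_cat e s t f : chips T e (s ++ t) f = chips T e s (chips T e t f).
Proof. by rewrite /chips foldr_cat. Qed.

Lemma chip_local e i f g k :
  f (step e i k) = g (step e i k) -> chip T e i f k = chip T e i g k.
Proof. by rewrite /chip => ->. Qed.

Lemma chips_local e s f g k :
  f (moves e s k) = g (moves e s k) -> chips T e s f k = chips T e s g k.
Proof.
elim: s k => [|i s IH] k //= fg.
by apply: chip_local; apply: IH.
Qed.

Lemma chip_comm i j f : i != j -> (1 <= i <= r)%N -> (1 <= j <= r)%N ->
  chip T true i (chip T false j f) = chip T false j (chip T true i f).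
Proof.
move=> ij hi hj.
have nz x z : (x <= r.+1)%N -> T x z != 0 by apply: T_neq0.
apply: functional_extensionality => k; apply: functional_extensionality => I.
have ji : j != i by rewrite eq_sym.
rewrite /chip /src /tgt /nbr [step false j (step _ _ _)]stepC !step_id.
rewrite !(step_neq _ _ _ _ ij) !(step_neq _ _ _ _ ji).
(* If i = j+1, both particles leave from the same site and each operator reads the row moved by the
   other; the diagonal ratio of one compensates the changed value read by the other. *)
have [e1|n1] := eqVneq i j.+1.
  subst i. rewrite /= !step_id !hopE !eqxx.
  decide_nat_eqs; rewrite ?step_id ?(step_neq _ _ _ _ ij) ?(step_neq _ _ _ _ ji).
  have nj z : T j z != 0 by apply: nz; lia.
  have nj1 z : T j.+1 z != 0 by apply: nz; lia.
  by case: (I j); case: (I j.+1); case: (I j.+2) => /=; field; rewrite ?nj ?nj1.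
have nb : i.-1 != j by lia.
rewrite (step_neq _ _ _ _ nb).
have [e2|n2] := eqVneq j i.+1.
  subst j. have n2 : i.+2 != i by lia. rewrite (step_neq _ _ _ _ n2) !hopE /= !eqxx.
  decide_nat_eqs; rewrite ?step_id ?(step_neq _ _ _ _ ij) ?(step_neq _ _ _ _ ji).
  have n1' z : T i z != 0 by apply: nz; lia.
  have n2' z : T i.+1 z != 0 by apply: nz; lia.
  by case: (I i); case: (I i.+1); case: (I i.+2) => /=; field; rewrite ?n1' ?n2'.
have nb' : j.+1 != i by rewrite eq_sym.
rewrite (step_neq _ _ _ _ nb') !hopE.
decide_nat_eqs; rewrite ?step_id ?(step_neq _ _ _ _ ij) ?(step_neq _ _ _ _ ji).
rewrite (hopC j.+1 j i i.+1); try lia.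
have nj z : T j z != 0 by apply: nz; lia.
have ni z : T i z != 0 by apply: nz; lia.
by case: (I i); case: (I i.+1); case: (I j); case: (I j.+1) => /=; field; rewrite ?nj ?ni.
Qed.

(** Both round trips return to [k]. For one particle at site i their diagonal entries are (T_i(k)^2
    + u v) / (T_i(k-1) T_i(k)) and T_i(k+1) / T_i(k), with u and v the neighbouring values; the
    relation identifies them. Site i+1 is similar. *)
Lemma chip_exchange i f k : (1 <= i <= r)%N ->
  T i (k i + 1) * T i (k i - 1)
    = T i (k i) ^+ 2 + T i.+1 (k i.+1) * T i.-1 (k i.-1) ->
  chip T true i (chip T false i f) k = chip T false i (chip T true i f) k.
Proof.
move=> hi q; apply: functional_extensionality => I.
rewrite /chip /src /tgt /nbr !(step_cancel true) !(step_cancel false) !step_id.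
have n1 : i.+1 != i by lia.
have n2 : i.-1 != i by lia.
rewrite !(step_neq _ _ _ _ n1) !(step_neq _ _ _ _ n2) /dir !hopE eqxx.
decide_nat_eqs.
have nz z : T i z != 0 by apply: T_neq0; lia.
(* Eliminating T_i(k+1) turns each case into an identity of rational functions. *)
have -> : T i (k i + 1) = (T i (k i) ^+ 2 + T i.+1 (k i.+1) * T i.-1 (k i.-1)) / T i (k i - 1).
  by rewrite -q mulfK.
have q0 : T i (k i) ^+ 2 + T i.+1 (k i.+1) * T i.-1 (k i.-1) != 0.
  by rewrite -q mulf_neq0.
case E1 : (I i); case E2 : (I i.+1) => /=; rewrite ?hopK ?E1 ?E2 //; by field; rewrite ?nz ?q0.
Qed.

Lemma chip_chips_comm i s f : (1 <= i <= r)%N -> {in s, forall j, (1 <= j <= r)%N} ->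
  i \notin s -> chip T true i (chips T false s f) = chips T false s (chip T true i f).
Proof.
move=> hi; elim: s => [|j s IH] //= hs; rewrite inE negb_or => /andP[ij is_].
have hj : (1 <= j <= r)%N by apply: hs; rewrite mem_head.
rewrite chip_comm ?IH // => x xs; apply: hs.
by rewrite inE xs orbT.
Qed.

Lemma chips_chip_comm i s f : (1 <= i <= r)%N -> {in s, forall j, (1 <= j <= r)%N} ->
  i \notin s -> chips T true s (chip T false i f) = chip T false i (chips T true s f).
Proof.
move=> hi; elim: s => [|j s IH] //= hs; rewrite inE negb_or => /andP[ij is_].
have hs' : {in s, forall j, (1 <= j <= r)%N} by move=> x xs; apply: hs; rewrite inE xs orbT.
have hj : (1 <= j <= r)%N by apply: hs; rewrite mem_head.
by rewrite IH // chip_comm // eq_sym.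
Qed.

Lemma chips_comm s t f : {in s, forall j, (1 <= j <= r)%N} ->
    {in t, forall j, (1 <= j <= r)%N} -> ~~ has (mem t) s ->
  chips T true s (chips T false t f) = chips T false t (chips T true s f).
Proof.
elim: s => [|i s IH] //= hs ht; rewrite negb_or => /andP[it st].
have hs' : {in s, forall j, (1 <= j <= r)%N} by move=> x xs; apply: hs; rewrite inE xs orbT.
have hi : (1 <= i <= r)%N by apply: hs; rewrite mem_head.
by rewrite IH // chip_chips_comm.
Qed.

Lemma chips_exchange s k f : uniq s -> {in s, forall j, (1 <= j <= r)%N} ->
    {in s, forall i, T i (k i + 1) * T i (k i - 1)
       = T i (k i) ^+ 2 + T i.+1 (k i.+1) * T i.-1 (k i.-1)} ->
  chips T true s (chips T false s f) k = chips T false s (chips T true s f) k.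
Proof.
elim: s f => [|i s IH] f //= /andP[is_ us] hs q.
have hi : (1 <= i <= r)%N by apply: hs; rewrite mem_head.
have hs' : {in s, forall j, (1 <= j <= r)%N} by move=> x xs; apply: hs; rewrite inE xs orbT.
rewrite chips_chip_comm // chip_exchange //; last by apply: q; rewrite mem_head.
(* The pair of moves of row i leads back to [k], where induction applies to the inner words. *)
rewrite -chip_chips_comm //; apply: chip_local; apply: chip_local.
rewrite (step_cancel true); apply: IH => // x xs; apply: q.
by rewrite inE xs orbT.
Qed.

End Relations.

(** * Ordered products along a Motzkin path *)

Section Transfer.
Variables (r : nat) (lo : int) (d : nat -> nat).

(** The path is recorded by heights [d] over a base level [lo], so that induction over blocks of
    equal height is possible. *)
Definition level (l : nat) : seq nat := [seq i <- iota 1 r | d i == l].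
Fixpoint up (h : nat) : seq nat := if h is h'.+1 then up h' ++ level h' else [::].
Fixpoint down (h : nat) : seq nat := if h is h'.+1 then level h' ++ down h' else [::].

Lemma mem_level l i : (i \in level l) = (1 <= i <= r)%N && (d i == l).
Proof. by rewrite mem_filter mem_iota andbC add1n ltnS. Qed.

Lemma count_level l i : count_mem i (level l) = (1 <= i <= r)%N && (d i == l).
Proof. by rewrite count_uniq_mem ?mem_level // filter_uniq // iota_uniq. Qed.

Lemma count_up h i : count_mem i (up h) = (1 <= i <= r)%N && (d i < h)%N.
Proof.
elim: h => [|h IH] /=; first by rewrite ltn0 andbF.
rewrite count_cat IH count_level; lia.
Qed.

Lemma count_down h i : count_mem i (down h) = count_mem i (up h).
Proof. by elim: h => [|h IH] //=; rewrite !count_cat IH addnC. Qed.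

Lemma mem_up h i : (i \in up h) = (1 <= i <= r)%N && (d i < h)%N.
Proof. by rewrite -has_pred1 has_count count_up; case: (_ && _). Qed.

Lemma mem_down h i : (i \in down h) = (1 <= i <= r)%N && (d i < h)%N.
Proof. by rewrite -has_pred1 has_count count_down count_up; case: (_ && _). Qed.

Lemma uniq_up h : uniq (up h).
Proof.
elim: h => [|h IH] //=; rewrite cat_uniq IH filter_uniq ?iota_uniq // andbT.
by apply/hasPn => j; rewrite mem_level /= mem_up => /andP[_ /eqP->]; rewrite ltnn andbF.
Qed.

Lemma uniq_down h : uniq (down h).
Proof.
elim: h => [|h IH] //=; rewrite cat_uniq IH filter_uniq ?iota_uniq // andbT.
by apply/hasPn => j; rewrite mem_down /= mem_level => /andP[_]; lia.
Qed.

(* The path m = lo + d shifted by c, after the rows with d i >= h went down. *)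
Definition partial_state (h : nat) (c : int) : nat -> int :=
  fun i => if (1 <= i <= r)%N then lo + (d i)%:Z + c - (h <= d i)%N%:Z else 0.

Variables (F : fieldType) (T : nat -> int -> F).
Hypothesis T_neq0 : forall a k, (a <= r.+1)%N -> T a k != 0.
Hypothesis T_Q : Qsystem r T.
Hypothesis d_motzkin : forall i, (1 <= i < r)%N -> `|(d i.+1)%:Z - (d i)%:Z| <= 1.

(** The boundary rows are constantly 1, so the default level 0 that [partial_state] gives them is
    harmless. *)
Lemma T_boundary i k k' : (i == 0)%N || (i == r.+1) -> T i k = T i k'.
Proof.
have [T1 _] := T_Q.
by case/orP => /eqP ->; [rewrite (T1 k).1 (T1 k').1 | rewrite (T1 k).2 (T1 k').2].
Qed.

Lemma T_Q_local (i : nat) (k : nat -> int) : (1 <= i <= r)%N ->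
  ((1 <= i.-1)%N -> k i.-1 = k i) -> ((i.+1 <= r)%N -> k i.+1 = k i) ->
  T i (k i + 1) * T i (k i - 1) = T i (k i) ^+ 2 + T i.+1 (k i.+1) * T i.-1 (k i.-1).
Proof.
move=> hi hl hr; have [_ ->] // := T_Q.
congr (_ + _ * _).
  by case: (ltnP i r) => h; [rewrite hr | apply: T_boundary; lia].
by case: (posnP i.-1) => h; [apply: T_boundary; lia | rewrite hl].
Qed.

(* The blocks of equal level are commuted one at a time: when level h is reached,
   the higher rows have been lowered and the lower rows raised, so that all
   neighbours of a row of level h are at its level. *)
Lemma down_up_partial h c f :
  chips T true (down h) (chips T false (up h) f) (partial_state h c)
    = chips T false (up h) (chips T true (down h) f) (partial_state h c).
Proof.
elim: h f => [|h IH] f //=.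
have hl l : {in level l, forall j, (1 <= j <= r)%N} by move=> j; rewrite mem_level => /andP[].
have hu l : {in up l, forall j, (1 <= j <= r)%N} by move=> j; rewrite mem_up => /andP[].
have hd l : {in down l, forall j, (1 <= j <= r)%N} by move=> j; rewrite mem_down => /andP[].
rewrite !chips_cat.
transitivity (chips T true (level h) (chips T false (up h)
   (chips T true (down h) (chips T false (level h) f))) (partial_state h.+1 c)).
  apply: chips_local.
  suff -> : moves true (level h) (partial_state h.+1 c) = partial_state h c by apply: IH.
  apply: functional_extensionality => i; rewrite movesE count_level /partial_state /dir.
  by case: ifP => hi //=; lia.
rewrite (chips_comm F r) //; last first.
  by apply/hasPn => j; rewrite mem_level => /andP[_ /eqP dj]; rewrite /= mem_up dj ltnn andbF.
rewrite (chips_comm F r T T_neq0 (down h)) //; last first.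
  by apply/hasPn => j; rewrite mem_down => /andP[_ dj]; rewrite /= mem_level; lia.
apply: chips_local; apply: (chips_exchange F r) => //.
  by rewrite filter_uniq // iota_uniq.
move=> i; rewrite mem_level => /andP[hi /eqP di].
(* By the Motzkin condition a neighbour differs from row i by at most one level, so its single move
   brings it level with row i. *)
apply: T_Q_local => //.
  move=> hi1; have hi' : (1 <= i.-1 <= r)%N by lia.
  have : (1 <= i.-1 < r)%N by lia.
  move=> /d_motzkin; rewrite prednK ?(ltnW hi1) //; last by lia.
  rewrite !movesE !count_up /partial_state /dir hi hi' /=; lia.
move=> hi1; have hi' : (1 <= i.+1 <= r)%N by lia.
have : (1 <= i < r)%N by lia.
move=> /d_motzkin; rewrite !movesE !count_up /partial_state /dir hi hi' /=; lia.
Qed.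

(** * The vacuum vector and its amplitudes *)

Definition occupied (alpha : nat) : nat -> bool := fun j => (j <= alpha)%N.

Definition vacuum (alpha : nat) (k : nat -> int) (I : nat -> bool) : F :=
  if all (fun j => I j == occupied alpha j) (iota 0 r.+2)
  then \prod_(1 <= j < alpha.+1) T j (k j) else 0.

(* Dividing by the rows below alpha compensates the determinants by which L_i
   acts when both of its sites are occupied. *)
Definition amplitude (alpha : nat) (G : (nat -> int) -> (nat -> bool) -> F)
    (k : nat -> int) : F :=
  G k (occupied alpha) / \prod_(1 <= j < alpha) T j (k j).

(** The ratio is the diagonal weight of [chip]: multiplying or dividing by such products cancels
    these weights. *)
Lemma prod_step e i n k : (1 <= i <= r)%N ->
  \prod_(1 <= j < n) T j (k j)
    = (if (i < n)%N then T i (k i) / T i (step e i k i) else 1)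
      * \prod_(1 <= j < n) T j (step e i k j).
Proof.
move=> hi; elim: n => [|n IH]; first by rewrite !big_geq ?mulr1.
have [->|n0] := posnP n; first by rewrite !big_geq // mulr1 ifF //; lia.
rewrite !big_nat_recr //= IH.
have nz z : T i z != 0 by apply: T_neq0; lia.
have [e1|n1] := eqVneq i n.
  subst i; rewrite ltnn ltnSn mul1r [RHS]mulrC -mulrA; congr (_ * _).
  by rewrite mulrC divfK.
rewrite (step_neq e i n k); last by rewrite eq_sym.
by rewrite mulrA ltnS [(i <= n)%N]leq_eqVlt (negbTE n1).
Qed.

Lemma chip_vacuum alpha i : (1 <= i <= r)%N ->
  chip T true i (vacuum alpha) = vacuum alpha.
Proof.
move=> hi; apply: functional_extensionality => k; apply: functional_extensionality => I.
rewrite /chip /vacuum [src true i]/= [tgt true i]/=.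
(* A hop leaves site i empty and site i+1 full, which is impossible in an initial segment. *)
have -> : all (fun j => hop i i.+1 I j == occupied alpha j) (iota 0 r.+2) = false.
  apply/negbTE/allPn; rewrite /occupied; case: (leqP i alpha) => ia.
    by exists i; rewrite ?mem_iota ?hopE ?eqxx ?ia //; lia.
  by exists i.+1; rewrite ?mem_iota ?hopE ?eqxx; decide_nat_eqs; lia.
rewrite mulr0 if_same addr0; case: allP => [hI|_]; last by rewrite mulr0.
rewrite (prod_step true i alpha.+1 k hi) ltnS -/(occupied alpha i).
by rewrite (eqP (hI i _)) // mem_iota; lia.
Qed.

Lemma chips_vacuum alpha s : {in s, forall j, (1 <= j <= r)%N} ->
  chips T true s (vacuum alpha) = vacuum alpha.
Proof.
elim: s => [|i s IH] //= hs.
rewrite IH; last by move=> x xs; apply: hs; rewrite inE xs orbT.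
by apply: chip_vacuum; apply: hs; rewrite mem_head.
Qed.

(** The hop from i+1 to i is blocked, as its target is full whenever its source is. The diagonal
    ratio occurs for i+1 <= alpha, exactly the rows in the denominator. *)
Lemma amplitude_chip alpha i G k : (1 <= i <= r)%N -> (alpha <= r)%N ->
  amplitude alpha (chip T false i G) k = amplitude alpha G (step false i k).
Proof.
move=> hi ha; rewrite /amplitude /chip /= /occupied.
have -> : (i < alpha)%N && ~~ (i <= alpha)%N = false by lia.
rewrite addr0 (prod_step false i alpha k hi).
have nz z : T i z != 0 by apply: T_neq0; lia.
case: ifP => _; last by rewrite !mul1r.
set P := \prod_(_ <= _ < _) _; rewrite invfM !mulrA; congr (_ / _).
by rewrite mulrC mulrA mulVf ?mul1r // mulf_neq0 ?invr_eq0.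
Qed.

Lemma amplitude_chips alpha s G k : {in s, forall j, (1 <= j <= r)%N} ->
  (alpha <= r)%N ->
  amplitude alpha (chips T false s G) k = amplitude alpha G (moves false s k).
Proof.
move=> hs ha; elim: s k hs => [|i s IH] k //= hs.
rewrite amplitude_chip // ?IH //; last by apply: hs; rewrite mem_head.
by move=> x xs; apply: hs; rewrite inE xs orbT.
Qed.

(** * The transfer operator over all rows *)

Variable h : nat.
Hypothesis d_lt : forall i, (1 <= i <= r)%N -> (d i < h)%N.

Lemma moves_down c :
  moves true (down h) (partial_state h c) = partial_state h (c - 1).
Proof.
apply: functional_extensionality => i.
rewrite movesE count_down count_up /partial_state /dir.
by case: ifP => // hi; have := d_lt i hi; lia.
Qed.

Lemma moves_up c :
  moves false (up h) (partial_state h c) = partial_state h (c + 1).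
Proof.
apply: functional_extensionality => i.
rewrite movesE count_up /partial_state /dir.
by case: ifP => // hi; have := d_lt i hi; lia.
Qed.

Definition transfer f := chips T true (down h) (chips T false (up h) f).

Lemma transfer_local f g c : f (partial_state h c) = g (partial_state h c) ->
  transfer f (partial_state h c) = transfer g (partial_state h c).
Proof.
move=> fg; apply: chips_local; apply: chips_local.
by rewrite moves_down moves_up subrK.
Qed.

(** R(RL) = R(LR) = (RL)R, the exchange taking place at the lowered state c-1. *)
Lemma down_iter_transfer p f c :
  chips T true (down h) (iter p transfer f) (partial_state h c)
    = iter p transfer (chips T true (down h) f) (partial_state h c).
Proof.
elim: p => [|p IH] //=; rewrite -(transfer_local _ _ _ IH).
apply: chips_local; rewrite moves_down; exact: down_up_partial.
Qed.

(** Rewrite the first RL as LR: the amplitude absorbs L, shifting c to c+1, and R passes through the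
    remaining factors to the vacuum, which it fixes. For p = 0 the quotient of products leaves the
    row alpha. *)
Lemma amplitude_transfer alpha p c : (1 <= alpha <= r)%N ->
  amplitude alpha (iter p transfer (vacuum alpha)) (partial_state h c)
    = T alpha (lo + (d alpha)%:Z + c + p%:Z).
Proof.
move=> ha; elim: p c => [|p IH] c /=.
  rewrite /amplitude /vacuum.
  have -> : all (fun j => occupied alpha j == occupied alpha j) (iota 0 r.+2).
    by apply/allP.
  rewrite big_nat_recr /=; last by lia.
  rewrite [X in X / _]mulrC mulfK; last first.
    rewrite prodf_seq_neq0; apply/allP => j; rewrite mem_index_iota => hj.
    by apply/implyP => _; apply: T_neq0; lia.
  by rewrite /partial_state ha leqNgt d_lt //= subr0 addr0.
rewrite /amplitude /transfer down_up_partial -/transfer -/(amplitude alpha _ _).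
rewrite amplitude_chips; [|by move=> j; rewrite mem_up => /andP[]|lia].
rewrite moves_up /amplitude down_iter_transfer chips_vacuum; last first.
  by move=> j; rewrite mem_down => /andP[].
by rewrite -/(amplitude alpha _ _) IH; congr (T _ _); lia.
Qed.

End Transfer.

(** * Positive Laurent expansions in the initial data *)

(** [P] is chosen before the field and the solution, so one expansion serves all of them, as for
    independent indeterminates. *)
Definition is_natLaurent (r : nat) (m : nat -> int)
    (g : forall F : fieldType, (nat -> int -> F) -> F) : Prop :=
  exists P : natLaurent r, forall (F : fieldType) (R : nat -> int -> F),
    Qsystem r R ->
    (forall (a : nat) (k : int), (1 <= a <= r)%N -> R a k != 0) ->
    g F R = laurent_eval P (fun i : 'I_r => R i.+1 (m i.+1))
                           (fun i : 'I_r => R i.+1 (m i.+1 + 1)).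

Section Positivity.
Variables (r : nat) (m : nat -> int).

Lemma natLaurent0 : is_natLaurent r m (fun F R => 0).
Proof. by exists [::] => F R _ _; rewrite /laurent_eval big_nil. Qed.

Lemma natLaurent1 : is_natLaurent r m (fun F R => 1).
Proof.
exists [:: (1%N, ([ffun=> 0], [ffun=> 0]))] => F R _ _.
rewrite /laurent_eval big_seq1 mul1r big1 // => i _.
by rewrite !ffunE !expr0z mulr1.
Qed.

Lemma natLaurentD g g' : is_natLaurent r m g -> is_natLaurent r m g' ->
  is_natLaurent r m (fun F R => g F R + g' F R).
Proof.
move=> [P hP] [Q hQ]; exists (P ++ Q) => F R q nz.
by rewrite (hP F R q nz) (hQ F R q nz) /laurent_eval big_cat.
Qed.

Lemma natLaurent_monomial (a b : {ffun 'I_r -> int}) g : is_natLaurent r m g ->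
  is_natLaurent r m (fun F R =>
    (\prod_(i < r) (R i.+1 (m i.+1) ^ a i * R i.+1 (m i.+1 + 1) ^ b i)) * g F R).
Proof.
move=> [P hP].
exists [seq (t.1, ([ffun i => a i + t.2.1 i], [ffun i => b i + t.2.2 i]))
  | t : nat * ({ffun 'I_r -> int} * {ffun 'I_r -> int}) <- P].
move=> F R q nz; rewrite (hP F R q nz) /laurent_eval big_map mulr_sumr.
apply: eq_bigr => t _ /=; rewrite mulrCA -big_split; congr (_ * _).
apply: eq_bigr => i _; rewrite !ffunE !expfzDr ?nz ?ltn_ord //.
by rewrite mulrACA.
Qed.

Lemma natLaurent_scale (i : nat) (k e : int) g : (i <= r.+1)%N ->
  ((1 <= i <= r)%N -> k = m i \/ k = m i + 1) ->
  is_natLaurent r m g -> is_natLaurent r m (fun F R => R i k ^ e * g F R).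
Proof.
move=> ir hk pg.
have [hi|hi] := boolP (1 <= i <= r)%N; last first.
  case: pg => P hP; exists P => F R q nz; rewrite -(hP F R q nz).
  have [R1 _] := q.
  have /orP[/eqP->|/eqP->] : (i == 0)%N || (i == r.+1) by lia.
    by rewrite (R1 k).1 exp1rz mul1r.
  by rewrite (R1 k).2 exp1rz mul1r.
have lt_i : (i.-1 < r)%N by lia.
pose o := Ordinal lt_i.
have oi : o.+1 = i by rewrite /= prednK //; lia.
(* The ordinal [o] = i-1 stands for row i; the monomial has exponent [e] there and 0 elsewhere. *)
pose one : {ffun 'I_r -> int} := [ffun j => if j == o then e else 0].
have [P hP] : is_natLaurent r m (fun F R => (\prod_(j < r) (R j.+1 (m j.+1) ^
    (if k == m i then one else [ffun=> 0]) j * R j.+1 (m j.+1 + 1) ^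
    (if k == m i then [ffun=> 0] else one) j)) * g F R).
  exact: natLaurent_monomial.
exists P => F R q nz; rewrite -hP //; congr (_ * _).
rewrite (bigD1 o) //= big1 ?mulr1; last first.
  by move=> j /negbTE jo; case: ifP => _; rewrite !ffunE jo !expr0z mulr1.
case: eqP => [->|km]; rewrite !ffunE eqxx expr0z ?mulr1 ?mul1r oi //.
by case: (hk hi) => [/km|->].
Qed.

Definition admissible (k : nat -> int) :=
  forall i, (1 <= i <= r)%N -> k i = m i \/ k i = m i + 1.

Lemma natLaurent_chip e i
    (G : forall F : fieldType, (nat -> int -> F) -> (nat -> int) -> (nat -> bool) -> F) k :
  (1 <= i <= r)%N -> admissible k -> admissible (step e i k) ->
  (forall I, is_natLaurent r m (fun F R => G F R (step e i k) I)) ->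
  forall I, is_natLaurent r m (fun F R => chip R e i (G F R) k I).
Proof.
move=> hi ak ak' hG I; rewrite /chip.
have ratio j I' : (j <= r.+1)%N -> is_natLaurent r m (fun F R =>
    R j (k j) / R i (step e i k i) * G F R (step e i k) I').
  move=> hj.
  have [P hP] : is_natLaurent r m (fun F R => R j (k j) ^ 1 *
      (R i (step e i k i) ^ (-1) * G F R (step e i k) I')).
    apply: natLaurent_scale => //; first by move=> h; apply: ak.
    apply: natLaurent_scale => //; first by lia.
    by move=> h; apply: ak'.
  by exists P => F R q nz; rewrite -hP // expr1z exprN1 mulrA.
apply: natLaurentD.
  case: (I (src e i)); first by apply: ratio; lia.
  by have [P hP] := hG I; exists P => F R q nz; rewrite -hP // mul1r.
case: (_ && _); last exact: natLaurent0.
by apply: ratio; rewrite /nbr; case: (e); lia.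
Qed.

(** A lowered row starts at m_i + 1, a raised one at m_i, and each moves once, so every weight
    involves only initial data and boundary values. *)
Lemma natLaurent_chips (e : bool) s
    (G : forall F : fieldType, (nat -> int -> F) -> (nat -> int) -> (nat -> bool) -> F) k :
  uniq s -> {in s, forall i, (1 <= i <= r)%N} -> admissible k ->
  {in s, forall i, k i = m i + (e : nat)%:Z} ->
  (forall I, is_natLaurent r m (fun F R => G F R (moves e s k) I)) ->
  forall I, is_natLaurent r m (fun F R => chips R e s (G F R) k I).
Proof.
elim: s k => [|i s IH] k //= /andP[is_ us] hs ak ks hG I.
have hi : (1 <= i <= r)%N by apply: hs; rewrite mem_head.
have ki : k i = m i + (e : nat)%:Z by apply: ks; rewrite mem_head.
have ak' : admissible (step e i k).
  move=> j hj; have [->|ji] := eqVneq j i; last by rewrite step_neq //; apply: ak.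
  by rewrite step_id ki /dir; case: (e) => /=; lia.
apply: (natLaurent_chip e i (fun F R => chips R e s (G F R))) => // J.
apply: IH => // [x xs|x xs]; first by apply: hs; rewrite inE xs orbT.
rewrite step_neq; first by apply: ks; rewrite inE xs orbT.
by apply: contraNneq is_ => <-.
Qed.

Lemma natLaurent_vacuum alpha k I : (alpha <= r)%N -> admissible k ->
  is_natLaurent r m (fun F R => vacuum r F R alpha k I).
Proof.
move=> ha ak; rewrite /vacuum; case: (all _ _); last exact: natLaurent0.
elim: alpha ha => [|n IH] hn.
  by have [P hP] := natLaurent1; exists P => F R q nz; rewrite -hP // big_geq.
have [P hP] : is_natLaurent r m (fun F R => R n.+1 (k n.+1) ^ 1 * \prod_(1 <= j < n.+1) R j (k j)).
  apply: natLaurent_scale; [lia | by move=> h; apply: ak |].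
  by apply: IH; lia.
by exists P => F R q nz; rewrite -hP // expr1z big_nat_recr //= mulrC.
Qed.

Lemma natLaurent_amplitude alpha k
    (G : forall F : fieldType, (nat -> int -> F) -> (nat -> int) -> (nat -> bool) -> F) :
  (alpha <= r)%N -> admissible k ->
  (forall I, is_natLaurent r m (fun F R => G F R k I)) ->
  is_natLaurent r m (fun F R => amplitude F R alpha (G F R) k).
Proof.
move=> ha ak hG; rewrite /amplitude.
suff H n : (n <= r.+1)%N -> is_natLaurent r m
    (fun F R => G F R k (occupied alpha) / \prod_(1 <= j < n) R j (k j)) by apply: H; lia.
elim: n => [|n IH] hn.
  have [P hP] := hG (occupied alpha).
  by exists P => F R q nz; rewrite -hP // big_geq // divr1.
have [->|n0] := posnP n.
  have [P hP] := hG (occupied alpha).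
  by exists P => F R q nz; rewrite -hP // big_geq // divr1.
have [P hP] : is_natLaurent r m (fun F R => R n (k n) ^ (-1) *
    (G F R k (occupied alpha) / \prod_(1 <= j < n) R j (k j))).
  apply: natLaurent_scale; [lia | by move=> h; apply: ak |].
  by apply: IH; lia.
by exists P => F R q nz; rewrite -hP // exprN1 big_nat_recr //= invfM mulrA mulrC.
Qed.

Lemma natLaurent_future alpha (p : nat) : motzkin r m -> (1 <= alpha <= r)%N ->
  is_natLaurent r m (fun F R => R alpha (m alpha + 1 + p%:Z)).
Proof.
move=> hm ha.
(* [N] bounds all |m_i|, so the shifted heights m_i + N are natural numbers below 2N+1. *)
pose N := \max_(i < r.+1) `|m i|%N.
have mN i : (i <= r)%N -> (`|m i| <= N)%N.
  by move=> ir; apply: (leq_bigmax (Ordinal (ir : (i < r.+1)%N))).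
pose d i := absz (m i + N%:Z).
pose lo : int := - N%:Z.
pose h := (N + N).+1.
have md i : (i <= r)%N -> lo + (d i)%:Z = m i by move=> /mN; rewrite /lo /d; lia.
have d_lt i : (1 <= i <= r)%N -> (d i < h)%N.
  by move=> /andP[_ /mN]; rewrite /d /h; lia.
have d_motzkin i : (1 <= i < r)%N -> `|(d i.+1)%:Z - (d i)%:Z| <= 1.
  move=> hi; have := hm i hi.
  have := mN i; have := mN i.+1; rewrite /d; lia.
have K1 i : (1 <= i <= r)%N -> partial_state r lo d h 1 i = m i + 1.
  by move=> hi; rewrite /partial_state hi leqNgt d_lt //= subr0 md //; lia.
have K0 i : (1 <= i <= r)%N -> partial_state r lo d h 0 i = m i.
  by move=> hi; rewrite /partial_state hi leqNgt d_lt //= subr0 addr0 md //; lia.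
have a1 : admissible (partial_state r lo d h 1) by move=> i /K1; right.
have a0 : admissible (partial_state r lo d h 0) by move=> i /K0; left.
have [P hP] : is_natLaurent r m (fun F R => amplitude F R alpha
    (iter p (transfer r d F R h) (vacuum r F R alpha)) (partial_state r lo d h 1)).
  apply: natLaurent_amplitude => //; first by lia.
  elim: p => [|p IH] I; first by apply: natLaurent_vacuum => //; lia.
  apply: (natLaurent_chips true _ (fun F R => chips R false (up r d h)
     (iter p (transfer r d F R h) (vacuum r F R alpha)))) => //.
  - exact: uniq_down.
  - by move=> j; rewrite mem_down => /andP[].
  - by move=> j; rewrite mem_down => /andP[/K1].
  rewrite moves_down // subrr => J.
  apply: natLaurent_chips => //.
  - exact: uniq_up.
  - by move=> j; rewrite mem_up => /andP[].
  - by move=> j; rewrite mem_up addr0 => /andP[/K0].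
  by rewrite moves_up // add0r.
exists P => F R q nz; rewrite -hP // amplitude_transfer //.
  by rewrite md //; lia.
move=> a k ar; have [R1 _] := q.
have [->|a0'] := posnP a; first by rewrite (R1 k).1 oner_neq0.
by have [->|ar'] := eqVneq a r.+1; [rewrite (R1 k).2 oner_neq0 | apply: nz; lia].
Qed.

End Positivity.

(** * Conclusion by reflection of the levels *)

Theorem mainTheorem5 (r : nat) (hr : (1 <= r)%N) (m : nat -> int)
  (hm : motzkin r m) (alpha : nat) (n : int) (ha : (1 <= alpha <= r)%N) :
  exists P : natLaurent r,
    forall (F : fieldType) (R : nat -> int -> F),
      Qsystem r R ->
      (forall (a : nat) (k : int), (1 <= a <= r)%N -> R a k != 0) ->
      R alpha n = laurent_eval P (fun i : 'I_r => R i.+1 (m i.+1))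
                                 (fun i : 'I_r => R i.+1 (m i.+1 + 1)).
Proof.
have [hn|hn] := leP (m alpha + 1) n.
  have [P hP] := natLaurent_future r m alpha (absz (n - (m alpha + 1))%R) hm ha.
  by exists P => F R q nz; rewrite -hP //; congr (R _ _); lia.
(* Under k -> -k the levels m'_i and m'_i + 1 become m_i + 1 and m_i, so the two families of
   variables, and hence the exponents in the witness, are swapped. *)
pose m' i : int := - m i - 1.
have hm' : motzkin r m' by move=> i /hm; rewrite /m'; lia.
have [P hP] := natLaurent_future r m' alpha (absz (- n - (m' alpha + 1))%R) hm' ha.
exists [seq (t.1, (t.2.2, t.2.1))
  | t : nat * ({ffun 'I_r -> int} * {ffun 'I_r -> int}) <- P] => F R [q1 q2] nz.
have := hP F (fun a k => R a (- k)).
rewrite (_ : - (m' alpha + 1 + _) = n); last by rewrite /m'; lia.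
move=> ->; last by move=> a k; apply: nz.
  rewrite /laurent_eval big_map; apply: eq_bigr => t _; congr (_ * _).
  apply: eq_bigr => i _ /=; rewrite mulrC /m'.
  by congr (R _ _ ^ _ * R _ _ ^ _); lia.
split=> [k|a k ak]; first exact: q1.
by rewrite opprD opprB [1 - k]addrC mulrC q2.
Qed.
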